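(* Let $k =2^t$ for some odd integer $t \geq 7$, let $m = \sqrt{2k}$, and let $n = \frac{1}{4}km-k = (\frac{k}{2})^{3/2}-k$. Let $L$ be a graph of order $n$ that is a vertex disjoint union of $\frac{n}{m}$ copies of $K_m$. Then a partial $k$-star decomposition of $K_n$ whose leave is $L$ exists, and furthermore it cannot be embedded in a $k$-star decomposition of $K_{n+k}$, even though $\binom{n+k}{2} \equiv 0 \pmod{k}$.
   Context: All graphs are finite and simple. A $k$-star is a complete bipartite graph $K_{1,k}$. A $k$-star decomposition of a graph $G$ is a set of $k$-stars that are subgraphs of $G$ such that each edge of $G$ is in exactly one of the $k$-stars. A partial $k$-star decomposition of $G$ is a set of $k$-stars that are subgraphs of $G$ such that each edge of $G$ is in at most one of the $k$-stars; its leave is the graph with vertex set $V(G)$ whose edges are exactly the edges of $G$ that are in none of its $k$-stars. An embedding of a partial $k$-star decomposition $\mathcal{A}$ of a graph $G$ is a partial $k$-star decomposition $\mathcal{B}$ of a graph $H$ such that $\mathcal{A} \subseteq \mathcal{B}$ and $G$ is a subgraph of $H$; we then say $\mathcal{A}$ is embedded in $\mathcal{B}$. $K_m$ denotes the complete graph on $m$ vertices. *)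

(* Defs.v *)
From HB Require Import structures.
From mathcomp Require Import all_boot all_order all_algebra.

Set Implicit Arguments.
Unset Strict Implicit.
Unset Printing Implicit Defensive.

(* Finite simple graphs whose vertices lie in a finite ambient type T; an edge
   is a 2-element subset of the vertex set. The vertex set is kept separate
   from T, so that subgraphs and inclusions between sets of stars are literal.
   Pitfall: supergraphs also live in T, so a non-existence claim about larger
   graphs carries its full content only when quantified over every T. *)
Definition graph_axiom (T : finType) (VE : {set T} * {set {set T}}) : bool :=
  [forall e in VE.2, (e \subset VE.1) && (#|e| == 2)].

Record sgraph (T : finType) := SGraph {
  graph_val : {set T} * {set {set T}};
  graph_valP : graph_axiom graph_val
}.

HB.instance Definition _ (T : finType) := [isSub for @graph_val T].
HB.instance Definition _ (T : finType) := [Finite of sgraph T by <:].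

Definition vert (T : finType) (G : sgraph T) : {set T} := (graph_val G).1.
Definition edges (T : finType) (G : sgraph T) : {set {set T}} :=
  (graph_val G).2.

Definition subgraph (T : finType) (G H : sgraph T) : bool :=
  (vert G \subset vert H) && (edges G \subset edges H).

Definition is_complete (T : finType) (n : nat) (G : sgraph T) : Prop :=
  #|vert G| = n /\
  edges G = [set e : {set T} | (e \subset vert G) && (#|e| == 2)].

Definition is_star (T : finType) (k : nat) (S : sgraph T) : Prop :=
  exists (c : T) (X : {set T}),
    [/\ c \notin X, #|X| = k, vert S = c |: X
      & edges S = [set [set c; x] | x in X]].

Definition partial_star_decomposition (T : finType) (k : nat) (G : sgraph T)
    (A : {set sgraph T}) : Prop :=
  (forall S, S \in A -> is_star k S /\ subgraph S G) /\
  (forall e, e \in edges G -> #|[set S in A | e \in edges S]| <= 1).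

Definition star_decomposition (T : finType) (k : nat) (G : sgraph T)
    (A : {set sgraph T}) : Prop :=
  (forall S, S \in A -> is_star k S /\ subgraph S G) /\
  (forall e, e \in edges G -> #|[set S in A | e \in edges S]| = 1).

Lemma leave_subproof (T : finType) (G : sgraph T) (A : {set sgraph T}) :
  graph_axiom (vert G, edges G :\: \bigcup_(S in A) edges S).
Proof.
apply/forallP=> e; apply/implyP; rewrite inE => /andP[_ eG].
exact: (implyP (forallP (graph_valP G) e) eG).
Qed.

Definition leave (T : finType) (G : sgraph T) (A : {set sgraph T}) : sgraph T :=
  SGraph (leave_subproof G A).

Definition embedding (T : finType) (k : nat) (G : sgraph T)
    (A : {set sgraph T}) (H : sgraph T) (B : {set sgraph T}) : Prop :=
  [/\ partial_star_decomposition k H B, A \subset B & subgraph G H].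

Definition disjoint_union_of_complete (T : finType) (c m : nat)
    (L : sgraph T) : Prop :=
  exists C : 'I_c -> sgraph T,
    [/\ forall i, is_complete m (C i),
        forall i j, i != j -> [disjoint vert (C i) & vert (C j)],
        vert L = \bigcup_(i < c) vert (C i)
      & edges L = \bigcup_(i < c) edges (C i)].

(* Main.v *)
Require Import Defs.
From mathcomp Require Import all_boot all_order all_algebra.
From mathcomp Require Import zify ring.

Set Implicit Arguments.
Unset Strict Implicit.
Unset Printing Implicit Defensive.

Import GRing.Theory Num.Theory.

(** Write t = 2 s + 1 and g = 2 ^ (s - 2). Then k = 32 g^2, m = 8 g and
n + k = 64 g^3, so n = p m where p = 2 r and r = 4 g^2 - 2 g: the leave L
consists of p disjoint copies of K_m, and everything is arithmetic in g.

Existence. K_n minus L is the complete multipartite graph with p parts of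
size m. Orienting every edge of a star away from its centre, a k-star
decomposition is the same thing as an orientation all of whose outdegrees are
multiples of k: each out-neighbourhood is then cut into blocks of size k
([decomposition_of_orientation]). With c = m / 2 = 4 g, the average outdegree
(n - m) / 2 is 2 c r - c, whereas the multiples of k on either side of it are
2 c r + c^2 = g k and 2 c r - c^2 = (g - 1) k. The average is right if every
part contains c - 1 heavy vertices, of outdegree g k, and c + 1 light ones, of
outdegree (g - 1) k. Take a balanced orientation in which each part is related
to m other parts (a circulant graph on the parts) and, between related parts,
make all heavy-light edges leave their heavy end. A heavy vertex gains
m (c + 1) / 2 and a light one loses m (c - 1) / 2, which is exactly what is
needed ([outdegree_beats]).

Non-existence. Suppose that the stars of A are completed to a decomposition
of K_(n+k). An edge of L, or an edge joining two of the k new vertices, lies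
in no star of A, hence contains the centre of an added star. So the centres of
the added stars miss at most one vertex of each of the p cliques of L and at
most one new vertex: there are at least n + k - p - 1 added stars
([embedding_necessary_condition]). Counting edges, they number only
n + 3k/4 - 5m/8, which is smaller because p = k/4 - m/2
([extension_too_small]). *)

(** * Complete graphs and stars *)

Lemma set2_inj (T : finType) (u v x y : T) :
  [set u; v] = [set x; y] -> (u = x /\ v = y) \/ (u = y /\ v = x).
Proof.
move=> e; have := set21 u v; have := set22 u v; rewrite e !inE.
have := set21 x y; have := set22 x y; rewrite -e !inE.
move=> /orP[] /eqP hy /orP[] /eqP hx /orP[] /eqP hv /orP[] /eqP hu; subst; auto.
Qed.

Lemma sgraph_eq (T : finType) (G H : sgraph T) :
  vert G = vert H -> edges G = edges H -> G = H.
Proof.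
rewrite /vert /edges => hv he; apply: val_inj => /=.
by case: (graph_val G) (graph_val H) hv he => [? ?] [? ?] /= -> ->.
Qed.

Lemma edgeP (T : finType) (G : sgraph T) (e : {set T}) :
  e \in edges G -> exists u v, [/\ u != v, u \in vert G, v \in vert G & e = [set u; v]].
Proof.
move=> eG; have /implyP/(_ eG)/andP[/subsetP eV /cards2P[u [v [uv ee]]]] :=
  forallP (graph_valP G) e.
by exists u, v; split=> //; apply: eV; rewrite ee !inE eqxx ?orbT.
Qed.

Lemma complete_edgeP (T : finType) (n : nat) (G : sgraph T) (u v : T) :
  is_complete n G -> u \in vert G -> v \in vert G -> u != v ->
  [set u; v] \in edges G.
Proof.
move=> [_ ->] uG vG uv; rewrite inE cards2 uv andbT.
by apply/subsetP=> x /set2P[] ->.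
Qed.

Lemma card_complete_edges (T : finType) (n : nat) (G : sgraph T) :
  is_complete n G -> #|edges G| = 'C(n, 2).
Proof. by move=> [<- ->]; rewrite cards_draws. Qed.

Lemma card_star_edges (T : finType) (k : nat) (S : sgraph T) :
  is_star k S -> #|edges S| = k.
Proof.
move=> [c [X [cX <- _ ->]]]; rewrite card_in_imset // => x y xX yX.
by move/set2_inj => [] [] // cy xc; rewrite -xc xX in cX.
Qed.

(** As k is positive, every vertex of a k-star lies on one of its edges, so for
stars inclusion of edges suffices. *)
Lemma star_subgraph (T : finType) (k : nat) (S G : sgraph T) :
  0 < k -> is_star k S -> edges S \subset edges G -> subgraph S G.
Proof.
move=> k0 [c [X [cX cardX vS eS]]] sub; rewrite /subgraph sub andbT vS.
have sX x : x \in X -> (c \in vert G) && (x \in vert G).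
  move=> xX; have /edgeP[u [v [_ uG vG /set2_inj[] [-> ->]]]] :
    [set c; x] \in edges G by apply: (subsetP sub); rewrite eS; apply: imset_f.
  - by rewrite uG vG.
  - by rewrite uG vG.
have [x xX] : exists x, x \in X by apply/card_gt0P; rewrite cardX.
apply/subsetP=> y /setU1P[-> | /sX/andP[]//].
by case/andP: (sX x xX).
Qed.

Lemma star_subproof (T : finType) (c : T) (X : {set T}) :
  graph_axiom (c |: X, [set [set c; x] | x in X :\ c]).
Proof.
apply/forallP=> e; apply/implyP=> /imsetP[x /setD1P[xc xX] ->] /=.
rewrite cards2 [c == x]eq_sym xc andbT.
by apply/subsetP=> y /set2P[] ->; rewrite !inE ?eqxx ?xX ?orbT.
Qed.

(** The centre is removed from the leaves so that the definition is total. *)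
Definition star (T : finType) (c : T) (X : {set T}) : sgraph T :=
  SGraph (star_subproof c X).

Lemma edges_star (T : finType) (c : T) (X : {set T}) :
  c \notin X -> edges (star c X) = [set [set c; x] | x in X].
Proof.
move=> cX; rewrite /edges /=; have -> // : X :\ c = X.
by apply/setDidPl; rewrite disjoint_sym disjoints1.
Qed.

Lemma is_star_star (T : finType) (c : T) (X : {set T}) :
  c \notin X -> is_star #|X| (star c X).
Proof. by move=> cX; exists c, X; split=> //; apply: edges_star. Qed.

(** * From orientations to star decompositions *)

Lemma partition_into_blocks (T : finType) (k : nat) (X : {set T}) :
  0 < k -> k %| #|X| ->
  exists2 P : {set {set T}}, partition P X & {in P, forall Y : {set T}, #|Y| = k}.
Proof.
move=> k0; have [n] := ubnP #|X|; elim: n X => // n IH X; rewrite ltnS => Xn kX.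
have [-> | X0] := eqVneq X set0.
  by exists set0; [rewrite partition_set0 eqxx | move=> Y; rewrite inE].
have kleX : k <= #|X| by apply: dvdn_leq => //; rewrite card_gt0.
have [Y YX cY] : exists2 Y : {set T}, Y \subset X & #|Y| = k.
  have : 0 < #|[set A : {set T} | A \subset X & #|A| == k]|.
    by rewrite cards_draws bin_gt0.
  by case/card_gt0P=> Y; rewrite inE => /andP[YX /eqP]; exists Y.
have cXY : #|X :\: Y| = #|X| - k by rewrite cardsD (setIidPr YX) cY.
have [||P partP PK] := IH (X :\: Y); rewrite ?cXY ?dvdn_sub //; first by lia.
exists (Y |: P) => [|Z /setU1P[->//|/PK//]].
rewrite -[X](setID _ Y) (setIidPr YX); apply: partitionU1 => //.
  by rewrite -card_gt0 cY.
by rewrite disjoint_sym disjoints_subset subsetDr.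
Qed.

(** The relation [o] orients the edges of G outside L. The stars are the pairs
of a vertex and a block of its out-neighbourhood; asymmetry of [o] makes the
centre of the star through a given edge unique, and then the block is the one
that contains the other end. *)
Lemma decomposition_of_orientation (T : finType) (k : nat) (G L : sgraph T)
    (o : rel T) :
  0 < k -> vert L = vert G -> edges L \subset edges G ->
  (forall u v, o u v -> ~~ o v u) ->
  (forall u v, o u v -> [set u; v] \in edges G :\: edges L) ->
  (forall e, e \in edges G :\: edges L ->
     exists u v, o u v /\ e = [set u; v]) ->
  (forall u, k %| #|[set v | o u v]|) ->
  exists A : {set sgraph T},
    partial_star_decomposition k G A /\ leave G A = L.
Proof.
move=> k0 vLG eLG asym oGL GLo degk.
have /fin_all_exists2[P partP cardP] : forall u, exists2 P : {set {set T}},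
    partition P [set v | o u v] & {in P, forall Y : {set T}, #|Y| = k}.
  by move=> u; apply: partition_into_blocks.
pose A := \bigcup_u [set star u X | X in P u].
have out u X x : X \in P u -> x \in X -> o u x.
  by move=> XP xX; have := subsetP (partitionS (partP u) XP) x xX; rewrite inE.
have loopless u X : X \in P u -> u \notin X.
  by move=> XP; apply/negP=> /(out _ _ _ XP) ouu; have := asym _ _ ouu; rewrite ouu.
have arcs u X : X \in P u -> edges (star u X) = [set [set u; x] | x in X].
  by move=> XP; apply/edges_star/loopless.
have AP S : S \in A -> exists u X, X \in P u /\ S = star u X.
  by case/bigcupP=> u _ /imsetP[X XP ->]; exists u, X.
have uniqS u v : o u v ->
    [set S in A | [set u; v] \in edges S] = [set star u (pblock (P u) v)].
  move=> ouv; have vP : v \in cover (P u).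
    by rewrite (cover_partition (partP u)) inE.
  apply/setP=> S; rewrite inE in_set1; apply/andP/eqP.
    move=> [/AP[u' [X [XP ->]]]]; rewrite arcs // => /imsetP[x xX /set2_inj[] [uu vx]].
      by subst; rewrite (def_pblock (partition_trivIset (partP _)) XP xX).
    by subst; have := asym _ _ ouv; rewrite (out _ _ _ XP xX).
  move=> ->; have bP := pblock_mem vP; split.
    by apply/bigcupP; exists u => //; apply: imset_f.
  by rewrite arcs //; apply: imset_f; rewrite mem_pblock.
have covA : \bigcup_(S in A) edges S = edges G :\: edges L.
  apply/setP=> e; apply/bigcupP/idP.
    move=> [S /AP[u [X [XP ->]]]]; rewrite arcs // => /imsetP[x xX ->].
    exact: oGL (out _ _ _ XP xX).
  case/GLo=> u [v [ouv ->]].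
  have := set11 (star u (pblock (P u) v)); rewrite -uniqS // inE => /andP[SA eS].
  by exists (star u (pblock (P u) v)).
exists A; split; last first.
  apply: sgraph_eq; first by rewrite vLG.
  by rewrite [LHS]/edges /= covA setDDr setDv set0U; apply/setIidPr.
split=> [S SA | e eG].
  have starS : is_star k S.
    have [u [X [XP ->]]] := AP S SA; rewrite -(cardP _ _ XP).
    exact/is_star_star/loopless.
  split=> //; apply: star_subgraph k0 starS _.
  apply: subset_trans (subsetDl _ (edges L)); rewrite -covA.
  exact: bigcup_sup.
have [eGL | eL] := boolP (e \in edges G :\: edges L).
  by have [u [v [ouv ->]]] := GLo _ eGL; rewrite uniqS // cards1.
have -> : [set S in A | e \in edges S] = set0; last by rewrite cards0.
apply/setP=> S; rewrite !inE; apply/negP=> /andP[SA eS].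
by case/negP: eL; rewrite -covA; apply/bigcupP; exists S.
Qed.

(** * An orientation of a complete multipartite graph *)

(** The residue of j - i modulo p, for i and j less than p. *)
Definition cyclic_gap (p i j : nat) : nat :=
  if i <= j then j - i else j + p - i.

(** In a part of size 2 c this singles out c - 1 vertices. *)
Definition heavy (c x : nat) : bool := x.+1 < c.

(** The orientation of the complete multipartite graph with 2 r parts of size
2 c, whose vertices are the pairs (i, x) of a part and a position in it. The
parts are arranged in a circle. Two parts at cyclic distance at most c are
related: between them, heavy beats light, and edges between vertices of the
same weight go forwards along the circle. Between other parts all edges go
forwards, except for opposite parts, at distance r, where forwards is
meaningless: there each vertex beats the half of the opposite part given by a
parity condition. The summand [i < r] distinguishes the two opposite parts, and
so makes the condition antisymmetric. *)
Definition beats (c r i j x y : nat) : bool :=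
  let d := cyclic_gap r.*2 i j in
  if d == 0 then false
  else if d == r then odd (x + y + (i < r))
  else if (d <= c) || (r.*2 <= d + c) then
    (heavy c x && ~~ heavy c y) || ((d < r) && (heavy c x == heavy c y))
  else d < r.

Lemma beatsC (c r i j x y : nat) : c < r -> i < r.*2 -> j < r.*2 -> i != j ->
  beats c r j i y x = ~~ beats c r i j x y.
Proof.
move=> cr ip jp ij; rewrite /beats.
set d := cyclic_gap _ i j; set e := cyclic_gap _ j i.
(* The gaps in the two directions add up to the number 2 r of parts. *)
have [de d0 e0] : [/\ d + e = r.*2, d != 0 & e != 0].
  by rewrite /d /e /cyclic_gap;
    case: (leqP i j) => h; case: (leqP j i) => h'; split; lia.
have opp : d = r -> (j < r) = ~~ (i < r)
  by rewrite /d /cyclic_gap; case: (leqP i j) => ij' dr; lia.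
rewrite (negbTE d0) (negbTE e0).
have -> : (e == r) = (d == r) by lia.
have [dr | dr] := eqVneq d r.
  by rewrite opp // !oddD !oddb; case: odd; case: odd; case: (i < r).
have -> : ((e <= c) || (r.*2 <= e + c)) = ((d <= c) || (r.*2 <= d + c)) by lia.
have -> : (e < r) = ~~ (d < r) by lia.
by case: ifP => _ //; case: (heavy c x); case: (heavy c y); case: (d < r).
Qed.

Lemma beats_same (c r i x y : nat) : beats c r i i x y = false.
Proof. by rewrite /beats /cyclic_gap leqnn subnn. Qed.

(** Seen from part i, the parts are met once at each gap, part i itself at gap 0. *)
Lemma sum_cyclic_gap (p i : nat) (F : nat -> nat) : i <= p ->
  \sum_(j < p) F (cyclic_gap p i j) = \sum_(0 <= d < p) F d.
Proof.
move=> ip; rewrite -(big_mkord xpredT (fun j => F (cyclic_gap p i j))).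
rewrite (@big_cat_nat _ _ _ i) //= [RHS](@big_cat_nat _ _ _ (p - i)) ?leq_subr //= addnC.
rewrite -{1}[i]add0n big_addn; congr (_ + _).
  by apply: eq_big_nat => j _; rewrite /cyclic_gap leq_addl addnK.
rewrite -[in RHS](add0n (p - i)) big_addn subKn //; apply: eq_big_nat => j /andP[_ ji].
by rewrite /cyclic_gap leqNgt ji /= addnBA.
Qed.

Lemma sum_const_range (a b n : nat) (F : nat -> nat) :
  (forall d, a <= d < b -> F d = n) -> \sum_(a <= d < b) F d = (b - a) * n.
Proof. by move=> Fn; rewrite -sum_nat_const_nat; apply: eq_big_nat. Qed.

Lemma sum_heavy (c : nat) : 0 < c -> \sum_(y < c.*2) heavy c y = c.-1.
Proof.
move=> c0; rewrite -(big_mkord xpredT (fun y => heavy c y : nat)).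
rewrite (@big_cat_nat _ _ _ c.-1) //=; last by lia.
rewrite (@sum_const_range 0 _ 1); last by rewrite /heavy; lia.
rewrite (@sum_const_range _ _ 0); last by rewrite /heavy; lia.
lia.
Qed.

Lemma sum_light (c : nat) : 0 < c -> \sum_(y < c.*2) ~~ heavy c y = c.+1.
Proof.
move=> c0; have := sum_heavy c0.
have : \sum_(y < c.*2) (heavy c y + ~~ heavy c y) = c.*2.
  rewrite (eq_bigr (fun=> 1)); first by rewrite sum1_card card_ord.
  by move=> y _; case: heavy.
rewrite big_split /=; lia.
Qed.

Lemma sum_odd (c x b : nat) : \sum_(y < c.*2) odd (x + y + b) = c.
Proof.
elim: c => [|c IH]; first by rewrite big_ord0.
rewrite doubleS !big_ord_recr /= IH; move: (c.*2) => d.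
by rewrite !oddD /=; case: (odd x); case: (odd b); case: (odd d);
  rewrite /= ?addn0 ?addn1.
Qed.

(** Summation over the gap d. At d = r a vertex wins c times. For 0 < d <= c it
wins against the whole part if it is heavy and against the c + 1 light
vertices if it is light; for 2 r - c <= d only a heavy vertex wins, against the
light ones. The other gaps contribute a full part when d < r and nothing when
d > r. *)
Lemma outdegree_beats (c r i x : nat) : 0 < c -> c < r -> i < r.*2 ->
  \sum_(j < r.*2) \sum_(y < c.*2) beats c r i j x y =
  if heavy c x then (c * r).*2 + c ^ 2 else (c * r).*2 - c ^ 2.
Proof.
move=> c0 cr ip.
pose F d := \sum_(y < c.*2) (if d == 0 then false
  else if d == r then odd (x + y + (i < r))
  else if (d <= c) || (r.*2 <= d + c) then
    (heavy c x && ~~ heavy c y) || ((d < r) && (heavy c x == heavy c y))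
  else d < r).
rewrite (eq_bigr (fun j : 'I__ => F (cyclic_gap r.*2 i j))) //.
rewrite (@sum_cyclic_gap r.*2 i F) ?(ltnW ip) //.
have full : \sum_(y < c.*2) 1 = c.*2 by rewrite sum1_card card_ord.
have empty : \sum_(y < c.*2) 0 = 0 by rewrite big1.
rewrite (@big_cat_nat _ _ _ 1) //=; last lia.
rewrite (@big_cat_nat _ _ _ c.+1 1) //=; last lia.
rewrite (@big_cat_nat _ _ _ r c.+1) //=; last lia.
rewrite (@big_cat_nat _ _ _ r.+1 r) //=; last lia.
rewrite (@big_cat_nat _ _ _ (r.*2 - c) r.+1) //=; try lia.
rewrite !big_nat1.
have -> : F 0 = 0 by rewrite /F big1.
have -> : F r = c.
  have r0 : (r == 0) = false by lia.
  by rewrite /F r0 eqxx sum_odd.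
rewrite (@sum_const_range 1 _ (if heavy c x then c.*2 else c.+1)); last first.
  move=> d dc; rewrite /F.
  have [-> -> -> ->] : [/\ (d == 0) = false, (d == r) = false,
    (d <= c) || (r.*2 <= d + c) = true & (d < r) = true] by split; lia.
  case: heavy => /=; last by rewrite -sum_light.
  by rewrite -[RHS]full; apply: eq_bigr => y _; case: heavy.
rewrite (@sum_const_range c.+1 _ c.*2); last first.
  move=> d dc; rewrite /F.
  have [-> -> -> ->] // : [/\ (d == 0) = false, (d == r) = false,
    (d <= c) || (r.*2 <= d + c) = false & (d < r) = true] by split; lia.
rewrite (@sum_const_range r.+1 _ 0); last first.
  move=> d dc; rewrite /F.
  have [-> -> -> ->] // : [/\ (d == 0) = false, (d == r) = false,
    (d <= c) || (r.*2 <= d + c) = false & (d < r) = false] by split; lia.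
rewrite (@sum_const_range (r.*2 - c) _ (if heavy c x then c.+1 else 0)); last first.
  move=> d dc; rewrite /F.
  have [-> -> -> ->] : [/\ (d == 0) = false, (d == r) = false,
    (d <= c) || (r.*2 <= d + c) = true & (d < r) = false] by split; lia.
  case: heavy => //=.
  by rewrite -sum_light //; apply: eq_bigr => y _; rewrite orbF.
have := leq_mul (ltnW cr) (leqnn c).
case: heavy; nia.
Qed.

(** * Decomposing the complement of a disjoint union of complete graphs *)

Lemma disjoint_union_coordinates (T : finType) (p m : nat) (L : sgraph T) :
  disjoint_union_of_complete p m L ->
  exists f : 'I_p * 'I_m -> T,
    [/\ injective f, vert L = [set f a | a : 'I_p * 'I_m]
      & forall a b, a != b -> ([set f a; f b] \in edges L) = (a.1 == b.1)].
Proof.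
move=> [C [complC disjC vL eL]].
have cardC i : #|vert (C i)| = m by case: (complC i).
pose f (a : 'I_p * 'I_m) := enum_val (cast_ord (esym (cardC a.1)) a.2).
have fC a : f a \in vert (C a.1) by apply: enum_valP.
have part x i j : x \in vert (C i) -> x \in vert (C j) -> i = j.
  move=> xi xj; apply/eqP; apply: contraT => /disjC.
  by rewrite -setI_eq0 => /eqP/setP/(_ x); rewrite !inE xi xj.
have f_inj : injective f.
  move=> [i x] [j y] e; have ij : i = j.
    by apply: (part (f (i, x)) i j (fC (i, x))); rewrite e; apply: fC (j, y).
  by subst j; move/enum_val_inj/cast_ord_inj: e => /= ->.
exists f; split=> // [|a b ab].
  rewrite vL; apply/setP=> x; apply/bigcupP/imsetP.
    move=> [i _ xi]; exists (i, cast_ord (cardC i) (enum_rank_in xi x)) => //.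
    by rewrite /f /= cast_ord_comp cast_ord_id enum_rankK_in.
  by move=> [a _ ->]; exists a.1.
rewrite eL; apply/bigcupP/eqP.
  move=> [i _]; have [_ ->] := complC i; rewrite inE => /andP[/subsetP sub _].
  rewrite (part _ _ _ (fC a) (sub _ (set21 _ _))).
  by rewrite (part _ _ _ (fC b) (sub _ (set22 _ _))).
move=> ab1; exists a.1 => //; apply: complete_edgeP (complC _) (fC a) _ _.
  by rewrite ab1.
by rewrite (inj_eq f_inj).
Qed.

Lemma complete_graph_exists (T : finType) (V : {set T}) :
  exists2 G : sgraph T, vert G = V & is_complete #|V| G.
Proof.
have GP : graph_axiom (V, [set e : {set T} | (e \subset V) && (#|e| == 2)]).
  by apply/forallP=> e; rewrite inE implybb.
by exists (SGraph GP).
Qed.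

(** The two divisibility hypotheses are about the outdegrees of the heavy and of
the light vertices. *)
Lemma complete_multipartite_decomposition (T : finType) (k c r : nat)
    (L : sgraph T) :
  0 < k -> 0 < c -> c < r ->
  k %| (c * r).*2 + c ^ 2 -> k %| (c * r).*2 - c ^ 2 ->
  disjoint_union_of_complete r.*2 c.*2 L ->
  exists (G : sgraph T) (A : {set sgraph T}),
    [/\ is_complete #|vert L| G, partial_star_decomposition k G A
      & leave G A = L].
Proof.
move=> k0 c0 cr kplus kminus /disjoint_union_coordinates[f [f_inj vL eL]].
have [G vG complG] := complete_graph_exists (vert L); exists G.
pose R (a b : 'I_r.*2 * 'I_c.*2) := beats c r a.1 b.1 a.2 b.2.
have RC a b : a.1 != b.1 -> R b a = ~~ R a b by move=> ab; apply: beatsC.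
have R1 a b : R a b -> a.1 != b.1.
  by apply: contraTneq => e; rewrite /R e beats_same.
pose o u v := [exists a, exists b, [&& u == f a, v == f b & R a b]].
have oP u v : reflect (exists a b, [/\ u = f a, v = f b & R a b]) (o u v).
  apply: (iffP existsP) => [[a /existsP[b /and3P[/eqP-> /eqP-> Rab]]]|].
    by exists a, b.
  by move=> [a [b [-> -> Rab]]]; exists a; apply/existsP; exists b; rewrite !eqxx.
have oE a b : o (f a) (f b) = R a b.
  by apply/oP/idP => [[a' [b' [/f_inj-> /f_inj->]]] | Rab] //; exists a, b.
have eG a b : a != b -> [set f a; f b] \in edges G :\: edges L = (a.1 != b.1).
  move=> ab; rewrite inE eL // andbC (complete_edgeP complG) ?vG ?vL ?imset_f //.
  by rewrite (inj_eq f_inj).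
have [//|||||u|A [AG leaveA]] := @decomposition_of_orientation T k G L o k0.
- apply/subsetP=> e eL'; have [u [v [uv uL vL' ->]]] := edgeP eL'.
  by rewrite (complete_edgeP complG) ?vG.
- by move=> u v /oP[a [b [-> -> Rab]]]; rewrite oE (RC a b (R1 _ _ Rab)) Rab.
- move=> u v /oP[a [b [-> -> Rab]]]; have ab1 := R1 _ _ Rab.
  by rewrite eG //; apply: contraNneq ab1 => ->.
- move=> e eGL; have /setDP[/edgeP[u [v [uv]]]] := eGL.
  rewrite vG vL => /imsetP[a _ ua] /imsetP[b _ vb] ee _; subst u v e.
  have ab : a != b by apply: contraNneq uv => ->.
  move: eGL; rewrite eG // => ab1; case Rab: (R a b).
    by exists (f a), (f b); rewrite oE.
  by exists (f b), (f a); rewrite oE RC // Rab setUC.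
- have [/imsetP[a _ ->] | uL] :=
    boolP (u \in [set f a | a : 'I_r.*2 * 'I_c.*2]); last first.
    have -> : [set v | o u v] = set0; last by rewrite cards0.
    apply/setP=> v; rewrite !inE; apply: contraNF uL => /oP[a [_ [-> _ _]]].
    exact: imset_f.
  have -> : [set v | o (f a) v] = f @: [set b | R a b].
    apply/setP=> v; rewrite inE; apply/oP/imsetP.
      by move=> [a' [b [/f_inj<- -> Rab]]]; exists b; rewrite ?inE.
    by move=> [b]; rewrite inE => Rab ->; exists a, b.
  rewrite card_imset // -sum1_card big_mkcond /=.
  have -> : \sum_b (if b \in [set b | R a b] then 1 else 0) =
     \sum_(j < r.*2) \sum_(y < c.*2) beats c r a.1 j a.2 y.
    rewrite pair_big; apply: eq_bigr => -[j y] _; rewrite inE /R /=.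
    by case: beats.
  by rewrite outdegree_beats //; case: ifP.
by exists A.
Qed.

(** * An obstruction to embeddings *)

Lemma card_partial_star_decomposition (T : finType) (k : nat) (G : sgraph T)
    (A : {set sgraph T}) :
  partial_star_decomposition k G A ->
  k * #|A| + #|edges (leave G A)| = #|edges G|.
Proof.
move=> [starA atmost1].
have -> : k * #|A| = \sum_(e in edges G) #|[set S in A | e \in edges S]|.
  rewrite mulnC -sum_nat_const (eq_bigr (fun S => \sum_(e in edges G) (e \in edges S))).
    rewrite exchange_big; apply: eq_bigr => e _.
    by rewrite -sum1dep_card big_mkcondr; apply: eq_bigr => S _; case: (e \in _).
  move=> S /starA[/card_star_edges <- /andP[_ /setIidPr eS]].
  rewrite -[in LHS]eS -sum1_card; under eq_bigl do rewrite inE.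
  by rewrite big_mkcondr; apply: eq_bigr => e _; case: (e \in _).
have -> : #|edges (leave G A)| = \sum_(e in edges G) (e \in edges (leave G A)).
  rewrite -sum1_card (eq_bigl (fun e => (e \in edges G) && (e \in edges (leave G A)))).
    by rewrite big_mkcondr; apply: eq_bigr => e _; case: (e \in _).
  by move=> e; rewrite inE; case: (e \in edges G); rewrite ?andbF.
rewrite -big_split /= -sum1_card; apply: eq_bigr => e eG; rewrite inE eG andbT.
have := atmost1 e eG; case: bigcupP => [[S SA eS] | none] le1 /=.
  rewrite addn0; apply/eqP; rewrite eqn_leq le1.
  by apply/card_gt0P; exists S; rewrite inE SA.
suff -> : [set S in A | e \in edges S] = set0 by rewrite cards0.
by apply/setP=> S; rewrite !inE; apply/negP=> /andP[SA eS]; case: none; exists S.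
Qed.

Lemma card_disjoint_union_edges (T : finType) (p m : nat) (L : sgraph T) :
  disjoint_union_of_complete p m L -> #|edges L| = p * 'C(m, 2).
Proof.
move=> [C [complC disjC _ ->]]; rewrite -sum1_card partition_disjoint_bigcup.
  rewrite (eq_bigr (fun=> 'C(m, 2))) ?sum_nat_const ?card_ord // => i _.
  by rewrite sum1_card (card_complete_edges (complC i)).
move=> i j /disjC; rewrite -!setI_eq0 => /eqP/setP disj.
apply/eqP/setP=> e; rewrite !inE; apply/negP=> /andP[/edgeP[u [v [_ ui _ ->]]]].
case/edgeP=> x [y [_ xj yj e']]; have := disj u; rewrite !inE ui /=.
by have := set21 u v; rewrite e' => /set2P[] ->; rewrite ?xj ?yj.
Qed.

(** A centre of each star suffices for K. *)
Lemma star_transversal (T : finType) (k : nat) (D : {set sgraph T}) :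
  (forall S, S \in D -> is_star k S) ->
  exists2 K : {set T}, #|K| <= #|D|
    & forall S e, S \in D -> e \in edges S -> exists2 c, c \in K & c \in e.
Proof.
move=> starD; have [-> | [S0 S0D]] := set_0Vmem D.
  by exists set0; rewrite ?cards0 // => S e; rewrite inE.
have [c0 _] := starD _ S0D.
have /fin_all_exists[c cP] S : exists c, S \in D ->
    forall e, e \in edges S -> c \in e.
  have [/starD[c [X [_ _ _ ->]]]|] := boolP (S \in D); last by exists c0.
  by exists c => _ e /imsetP[x _ ->]; apply: set21.
exists (c @: D) => [|S e SD eS]; first exact: leq_imset_card.
by exists (c S); [apply: imset_f | apply: cP].
Qed.

Lemma card_clique_avoiding (T : finType) (X K : {set T}) :
  {in X &, forall u v, u != v -> exists2 c, c \in K & c \in [set u; v]} ->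
  #|X :\: K| <= 1.
Proof.
move=> hit; apply/card_le1_eqP => u v /setDP[uX uK] /setDP[vX vK].
apply/eqP; apply: contraT => uv.
have [c cK /set2P[] cE] := hit v u vX uX uv.
  by rewrite -cE cK in vK.
by rewrite -cE cK in uK.
Qed.

Lemma card_bigcup_le1 (T : finType) (p : nat) (F : 'I_p -> {set T}) :
  (forall i, #|F i| <= 1) -> #|\bigcup_i F i| <= p.
Proof.
move=> F1; apply: (@leq_trans (\sum_(i < p) 1)); last by rewrite sum1_card card_ord.
apply: (big_ind2 (fun (X : {set T}) n => #|X| <= n)); first by rewrite cards0.
  move=> X n Y n' Xn Yn'; apply: leq_trans (leq_add Xn Yn').
  by rewrite cardsU leq_subr.
by move=> i _; apply: F1.
Qed.

(** By counting edges, k times the number of stars of B that are not in A is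
'C(n + s, 2) - 'C(n, 2) + p 'C(m, 2). The set of their centres meets every edge
of the leave and every edge between vertices outside G, and a set meeting all
edges of a clique contains all its vertices but at most one; so there are at
least n + s - (p + 1) centres. *)
Lemma embedding_necessary_condition (T : finType) (k n s p m : nat)
    (G H : sgraph T) (A B : {set sgraph T}) :
  is_complete n G -> partial_star_decomposition k G A ->
  disjoint_union_of_complete p m (leave G A) ->
  is_complete (n + s) H -> star_decomposition k H B -> embedding k G A H B ->
  k * (n + s) + 'C(n, 2) <= 'C(n + s, 2) + p * 'C(m, 2) + k * p.+1.
Proof.
move=> complG decA unionL complH [starB coverB] [decB AB /andP[vGH eGH]].
have countA := card_partial_star_decomposition decA.
have countB := card_partial_star_decomposition decB.
rewrite (card_disjoint_union_edges unionL) (card_complete_edges complG) in countA.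
have inB e : e \in edges H -> exists2 S, S \in B & e \in edges S.
  move=> /coverB e1.
  have /card_gt0P[S] : 0 < #|[set S in B | e \in edges S]| by rewrite e1.
  by rewrite inE => /andP[SB eS]; exists S.
have leaveB : #|edges (leave H B)| = 0.
  apply/eqP; rewrite cards_eq0; apply/eqP/setP=> e; rewrite !inE.
  apply/negP=> /andP[/negP none /inB[S SB eS]]; apply: none.
  by apply/bigcupP; exists S.
rewrite leaveB addn0 (card_complete_edges complH) in countB.
have [S|K cardK hitK] := @star_transversal T k (B :\: A).
  by case/setDP=> /starB[].
rewrite cardsD (setIidPr AB) in cardK.
have hit e : e \in edges H -> (forall S, S \in A -> e \notin edges S) ->
    exists2 c, c \in K & c \in e.
  move=> /inB[S SB eS] new; apply: (hitK S) => //; rewrite inE SB andbT.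
  by apply: contraL eS => /new.
have [C [complC _ vL eL]] := unionL.
have missC i : #|vert (C i) :\: K| <= 1.
  apply: card_clique_avoiding => u v ui vi uv.
  have /setDP[eG new] : [set u; v] \in edges (leave G A).
    by rewrite eL; apply/bigcupP; exists i => //; apply: complete_edgeP (complC i) _ _ _.
  apply: hit => [|S SA]; first exact: (subsetP eGH).
  by apply: contra new => eS; apply/bigcupP; exists S.
have missW : #|(vert H :\: vert G) :\: K| <= 1.
  apply: card_clique_avoiding => u v /setDP[uH uG] /setDP[vH vG] uv.
  apply: hit => [|S SA]; first exact: complete_edgeP complH _ _ _.
  apply: contra uG => eS; have [_ /andP[_ sub]] := decA.1 _ SA.
  have /edgeP[x [y [_ xG yG e]]] := subsetP sub _ eS.
  by have := set21 u v; rewrite e => /set2P[] ->.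
have missH : #|vert H :\: K| <= p.+1.
  have sub : vert H :\: K \subset
      (vert H :\: vert G) :\: K :|: \bigcup_i (vert (C i) :\: K).
    apply/subsetP=> x /setDP[xH xK]; rewrite !inE xH xK /= andbT.
    have [xG /=|//] := boolP (x \in vert G).
    have : x \in \bigcup_i vert (C i) by rewrite -vL.
    by case/bigcupP=> i _ xi; apply/bigcupP; exists i => //; rewrite inE xK.
  apply: leq_trans (subset_leq_card sub) _; rewrite cardsU.
  apply: leq_trans (leq_subr _ _) _; rewrite -add1n.
  exact: leq_add missW (card_bigcup_le1 missC).
have [cH _] := complH.
have big : n + s <= #|B| - #|A| + p.+1.
  rewrite -cH -(cardsID K) leq_add //.
  by apply: leq_trans cardK; apply: subset_leq_card; apply: subsetIr.
have kAB : k * #|A| <= k * #|B| by rewrite leq_mul // subset_leq_card.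
have := leq_mul (leqnn k) big; rewrite [k * (_ + p.+1)]mulnDr mulnBr; lia.
Qed.

(** * The parameters *)

Lemma odd_power_of_two (t : nat) :
  odd t -> 7 <= t -> exists2 g, 1 < g & 2 ^ t = 32 * g ^ 2.
Proof.
move=> t_odd t7; exists (2 ^ (t./2 - 2)).
  by rewrite -{1}(expn0 2) ltn_exp2l //; lia.
by rewrite -expnM -[32]/(2 ^ 5) -expnD; congr (2 ^ _); lia.
Qed.

Lemma sqrt_natE (R : rcfType) (x : R) (a : nat) :
  (x = (a ^ 2)%:R -> Num.sqrt x = a%:R)%R.
Proof. by move=> ->; rewrite natrX sqrtr_sqr ger0_norm ?ler0n. Qed.

Lemma double_bin2 (n : nat) : 'C(n, 2) * 2 + n = n * n.
Proof. by rewrite mulnC -mul_bin_diag bin1; case: n => // n; rewrite mulnS addnC. Qed.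

(** After doubling and cancelling, the inequality becomes k < n + 2 k m; this uses
4 k p = k^2 - 2 k m and p m^2 = 2 k p. *)
Lemma extension_too_small (k m n p : nat) :
  0 < m -> m * m = 2 * k -> 4 * p + 2 * m = k -> n = p * m ->
  'C(n + k, 2) + p * 'C(m, 2) + k * p.+1 < k * (n + k) + 'C(n, 2).
Proof.
move=> m0 mm kE nE; have k0 : 0 < k by lia.
have km : k * 1 <= k * m by rewrite leq_mul.
have kk : k * (4 * p + 2 * m) = k * k by rewrite kE.
have := double_bin2 n; have := double_bin2 (n + k).
have pz : p * ('C(m, 2) * 2 + m) = p * (2 * k) by rewrite double_bin2 mm.
move: ('C(n, 2)) ('C(n + k, 2)) ('C(m, 2)) pz => x y z.
rewrite !(mulnDr, mulnDl, mulnS) in kk *; rewrite mulnA [k * n]mulnC => pz yE xE.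
rewrite -nE in pz; clear kE mm; lia.
Qed.

Theorem lemma15 (R : rcfType) (T : finType) (t k m n : nat) (L : sgraph T)
    (ht_odd : odd t) (ht : 7 <= t)
    (hk : k = 2 ^ t)
    (hm : (m%:R = Num.sqrt (2 * k%:R) :> R)%R)
    (hn : (n%:R = 1 / 4 * k%:R * m%:R - k%:R :> R)%R)
    (hL_order : #|vert L| = n)
    (hL : disjoint_union_of_complete (n %/ m) m L) :
  [/\ (n%:R = Num.sqrt (k%:R / 2) ^+ 3 - k%:R :> R)%R,
      exists (G : sgraph T) (A : {set sgraph T}),
        [/\ is_complete n G, partial_star_decomposition k G A
          & leave G A = L],
      forall (G : sgraph T) (A : {set sgraph T}),
        is_complete n G -> partial_star_decomposition k G A ->
        leave G A = L ->
        ~ exists (H : sgraph T) (B : {set sgraph T}),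
            [/\ is_complete (n + k) H, star_decomposition k H B
              & embedding k G A H B]
    & 'C(n + k, 2) = 0 %[mod k] ].
Proof.
have [g g1 kg] := odd_power_of_two ht_odd ht; rewrite -hk in kg.
have mE : m = (4 * g).*2.
  apply/eqP; rewrite -(eqr_nat R) hm; apply/eqP.
  by apply: sqrt_natE; rewrite kg -natrM; congr (_%:R)%R; rewrite -muln2; ring.
have nkE : n + k = 64 * g ^ 3.
  apply/eqP; rewrite -(eqr_nat R) natrD hn subrK kg mE -muln2.
  by rewrite !(natrX, natrM); apply/eqP; field.
have [r rE] : exists r, r + 2 * g = 4 * g ^ 2.
  by exists (4 * g ^ 2 - 2 * g); rewrite subnK //; nia.
have nE : n = r.*2 * m by rewrite mE; nia.
have pE : n %/ m = r.*2 by rewrite nE mulnK // mE; lia.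
rewrite pE in hL; split.
- rewrite (@sqrt_natE _ _ (4 * g)); last first.
    by rewrite kg !(natrX, natrM); field.
  apply/eqP; rewrite -subr_eq opprK -natrD nkE; apply/eqP.
  by rewrite -natrX; congr (_%:R)%R; ring.
- rewrite mE in hL; rewrite -hL_order.
  apply: complete_multipartite_decomposition hL; rewrite ?kg //; try nia.
  (* The outdegrees are g k and (g - 1) k. *)
  + by apply/dvdnP; exists g; nia.
  + by apply/dvdnP; exists g.-1; nia.
- move=> G A complG decA leaveA [H [B [complH decB embB]]].
  rewrite -leaveA in hL.
  have := embedding_necessary_condition complG decA hL complH decB embB.
  have mm : m * m = 2 * k by rewrite mE kg -muln2; ring.
  have kE : 4 * r.*2 + 2 * m = k by rewrite mE kg; lia.
  have m0 : 0 < m by rewrite mE; lia.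
  by rewrite leqNgt (extension_too_small m0 mm kE nE).
- rewrite mod0n; apply/eqP; rewrite -/(dvdn _ _) nkE kg.
  apply/dvdnP; exists (g * (64 * g ^ 3).-1).
  have := double_bin2 (64 * g ^ 3); nia.
Qed.
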